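(* Let $\mathbb{F}$ be a field of characteristic zero, let $W(2)$ be the 8-dimensional $\mathbb{F}$-algebra with basis $e_1,\dots,e_8$ defined in the context, and for $e\in W(2)$ let $\mathcal{O}(e)$ be the orbit of $e$ under the group of automorphisms $\{\mathcal{S}_b\mathcal{T}_a\mid a,b\in\mathbb{F},\ b\neq 0\}$ defined in the context. Let $\bar{\mathbb{F}}\subset\mathbb{F}^*$ be a set of representatives of the cosets of the subgroup $(\mathbb{F}^* )^2$ in $\mathbb{F}^*$. Then the set of nonzero idempotents of $W(2)$ (elements $e\ne 0$ with $e\cdot e=e$) equals the disjoint union of the following sets: 1. $\mathcal{O}\big(e_8+e_2-e_1+c(3e_8+e_5-2e_1)\big)$ ($c\in\mathbb{F}$); 2. $\mathcal{O}\big(-e_1+c(e_5-2e_1)+de_8\big)$ ($c,d\in\mathbb{F}$); 3. $\mathcal{O}\big(-e_1-2e_8+4e_3+e_6+3e_7+c(3e_8-e_5+2e_1)+de_4\big)$ ($c,d\in\mathbb{F}$); 4. $\mathcal{O}\big(-e_1-2e_8+c(3e_8-e_5+2e_1)+qe_4\big)$ ($c\in\mathbb{F}$, $q\in\bar{\mathbb{F}}$). (The sets in the union are indexed by the type 1–4 together with the values of the parameters.)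
   Context: Let $V_2$ be a 2-dimensional vector space over $\mathbb{F}$ with basis $v_1,v_2$. $W(2)$ is the vector space of all bilinear maps $V_2\times V_2\to V_2$ with the (not necessarily associative, not necessarily unital) product $$(A\cdot B)(x,y)=A(v_1,B(x,y))-B(A(v_1,x),y)-B(x,A(v_1,y)),\qquad x,y\in V_2.$$ For $i,j,k\in\{1,2\}$ let $\alpha_{ij}^k\in W(2)$ be given by $\alpha_{ij}^k(v_t,v_l)=\delta_{it}\delta_{jl}v_k$. The basis $e_1,\dots,e_8$ of $W(2)$ is $e_1=\alpha_{11}^1-\alpha_{12}^2-\alpha_{21}^2$, $e_2=\alpha_{11}^2$, $e_3=\alpha_{22}^2-\alpha_{12}^1-\alpha_{21}^1$, $e_4=\alpha_{22}^1$, $e_5=2\alpha_{11}^1+\alpha_{12}^2+\alpha_{21}^2$, $e_6=2\alpha_{22}^2+\alpha_{12}^1+\alpha_{21}^1$, $e_7=\alpha_{12}^1-\alpha_{21}^1$, $e_8=\alpha_{12}^2-\alpha_{21}^2$. For a linear automorphism $f$ of $V_2$ with $f(v_1)=v_1$, let $\Phi(f)$ be the automorphism of $W(2)$ given by $(\Phi(f)(A))(x,y)=f(A(f^{-1}(x),f^{-1}(y)))$. For $a\in\mathbb{F}$, $\mathcal{T}_a=\Phi(f)$ where $f(v_1)=v_1$, $f(v_2)=v_2+av_1$; for $b\in\mathbb{F}^*$, $\mathcal{S}_b=\Phi(g)$ where $g(v_1)=v_1$, $g(v_2)=\frac{1}{b}v_2$. For $e\in W(2)$, $\mathcal{O}(e)=\{\mathcal{S}_b\mathcal{T}_a(e)\mid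 a,b\in\mathbb{F},\ b\neq0\}$, which is the orbit of $e$ under the full automorphism group of $W(2)$. *)

(* Defs.v *)
From HB Require Import structures.
From mathcomp Require Import all_boot all_order all_algebra.
From mathcomp Require Import boolp classical_sets.

Set Implicit Arguments.
Unset Strict Implicit.
Unset Printing Implicit Defensive.

Import GRing.Theory.
Local Open Scope ring_scope.
Local Open Scope classical_set_scope.

(* Bilinear maps V x V -> V in curried form: [A x y] is A(x, y). *)
Notation W2 V := 'Hom(V, 'End(V)).

(* Meaningful only when b is bilinear; see [bilinE]. *)
Definition bilin (F : fieldType) (V : vectType F) (b : V -> V -> V) : W2 V :=
  linfun (fun x => linfun (b x) : 'End(V)).

Lemma bilinE (F : fieldType) (V : vectType F) (b : V -> V -> V) :
  (forall x, linear (b x)) -> (forall y, linear (b^~ y)) ->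
  forall x y, bilin b x y = b x y.
Proof.
move=> br bl x y.
have E z : (linfun (b z) : 'End(V)) =1 b z.
  pose h := GRing.isLinear.Build _ _ _ _ (b z) (br z).
  pose f : {linear V -> V} := HB.pack (b z) h.
  exact: (lfunE f).
have L : linear (fun z => linfun (b z) : 'End(V)).
  move=> a u w; apply/lfunP => t.
  by rewrite !lfunE /= !lfunE /= !E bl.
pose h := GRing.isLinear.Build _ _ _ _ _ L.
pose f : {linear V -> 'End(V)} := HB.pack (fun z => linfun (b z) : 'End(V)) h.
by rewrite /bilin (lfunE f) /= E.
Qed.

(* In everything below, v is the basis (v_1, v_2) of V, and the basis indices
   1, 2 are shifted to 0, 1 : 'I_2. *)

Definition mulW (F : fieldType) (V : vectType F) (v : 2.-tuple V)
    (A B : W2 V) : W2 V :=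
  bilin (fun x y => A v`_0 (B x y) - B (A v`_0 x) y - B x (A v`_0 y)).

Lemma mulWE (F : fieldType) (V : vectType F) (v : 2.-tuple V) (A B : W2 V) x y :
  mulW v A B x y = A v`_0 (B x y) - B (A v`_0 x) y - B x (A v`_0 y).
Proof.
have E a (p q r p' q' r' : V) : a *: p + p' - (a *: q + q') - (a *: r + r')
    = a *: (p - q - r) + (p' - q' - r').
  by rewrite !opprD !scalerDr !scalerN [X in X + _ = _]addrACA [LHS]addrACA.
rewrite /mulW bilinE // => z a u w;
  by rewrite -E ?linearP ?(add_lfunE, scale_lfunE) ?linearP.
Qed.

Definition alpha (F : fieldType) (V : vectType F) (v : 2.-tuple V)
    (i j k : 'I_2) : W2 V :=
  bilin (fun x y => (coord v i x * coord v j y) *: v`_k).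

Lemma alphaE (F : fieldType) (V : vectType F) (v : 2.-tuple V) :
  basis_of {:V} v -> forall i j k t l : 'I_2,
  alpha v i j k v`_t v`_l = ((i == t) && (j == l))%:R *: v`_k.
Proof.
move=> /basis_free fv i j k t l; rewrite /alpha bilinE.
- by rewrite !(coord_free _ _ fv) -natrM mulnb (eq_sym t) (eq_sym l).
- by move=> x a u w; rewrite linearP /= mulrDr scalerDl mulrCA scalerA.
- by move=> x a u w; rewrite linearP /= mulrDl scalerDl -mulrA scalerA.
Qed.

Section Basis.
Variables (F : fieldType) (V : vectType F) (v : 2.-tuple V).

Definition e1 : W2 V := alpha v 0 0 0 - alpha v 0 1 1 - alpha v 1 0 1.
Definition e2 : W2 V := alpha v 0 0 1.
Definition e3 : W2 V := alpha v 1 1 1 - alpha v 0 1 0 - alpha v 1 0 0.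
Definition e4 : W2 V := alpha v 1 1 0.
Definition e5 : W2 V := 2%:R *: alpha v 0 0 0 + alpha v 0 1 1 + alpha v 1 0 1.
Definition e6 : W2 V := 2%:R *: alpha v 1 1 1 + alpha v 0 1 0 + alpha v 1 0 0.
Definition e7 : W2 V := alpha v 0 1 0 - alpha v 1 0 0.
Definition e8 : W2 V := alpha v 0 1 1 - alpha v 1 0 1.

End Basis.

(* The linear map sending v_1 to w1 and v_2 to w2. *)
Definition endo (F : fieldType) (V : vectType F) (v : 2.-tuple V)
    (w1 w2 : V) : 'End(V) :=
  linfun (fun x => coord v 0 x *: w1 + coord v 1 x *: w2).

Lemma endoE (F : fieldType) (V : vectType F) (v : 2.-tuple V) (w1 w2 : V) :
  basis_of {:V} v ->
  endo v w1 w2 v`_0 = w1 /\ endo v w1 w2 v`_1 = w2.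
Proof.
move=> /basis_free fv.
pose b x := coord v 0 x *: w1 + coord v 1 x *: w2.
have L : linear b.
  move=> a x y; rewrite /b (linearP (coord v 0)) (linearP (coord v 1)) /=.
  by rewrite !scalerDl scalerDr !scalerA addrACA.
pose h := GRing.isLinear.Build _ _ _ _ b L.
pose f : {linear V -> V} := HB.pack b h.
have E : endo v w1 w2 =1 b by exact: (lfunE f).
have c i j := coord_free i (j : 'I_2) fv.
by rewrite !E /b (c 0 0) (c 1 0) (c 0 1) (c 1 1) !eqxx /= !scale0r !scale1r
  addr0 add0r.
Qed.

(* [f^-1%VF] is the inverse of f when f is bijective. *)
Definition Phi (F : fieldType) (V : vectType F) (f : 'End(V)) (A : W2 V) :
    W2 V :=
  bilin (fun x y => f (A (f^-1%VF x) (f^-1%VF y))).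

Lemma PhiE (F : fieldType) (V : vectType F) (f : 'End(V)) (A : W2 V) x y :
  Phi f A x y = f (A (f^-1%VF x) (f^-1%VF y)).
Proof.
rewrite /Phi bilinE // => z a u w;
  by do ?rewrite !(linearP, add_lfunE, scale_lfunE) /=.
Qed.

Definition Ta (F : fieldType) (V : vectType F) (v : 2.-tuple V) (a : F) :
    W2 V -> W2 V :=
  Phi (endo v v`_0 (v`_1 + a *: v`_0)).

Definition Sb (F : fieldType) (V : vectType F) (v : 2.-tuple V) (b : F) :
    W2 V -> W2 V :=
  Phi (endo v v`_0 (b^-1 *: v`_1)).

Definition orbitW (F : fieldType) (V : vectType F) (v : 2.-tuple V)
    (e : W2 V) : set (W2 V) :=
  [set A | exists a b : F, b != 0 /\ A = Sb v b (Ta v a e)].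

(* Q contains exactly one element of each coset q (F^* )^2 in F^*. *)
Definition square_class_reps (F : fieldType) (Q : set F) : Prop :=
  (forall q, Q q -> q != 0) /\
  (forall x : F, x != 0 ->
     exists! q, Q q /\ exists2 z : F, z != 0 & x = q * z ^+ 2).

(* Indices of the union: a type number together with parameter values. *)
Inductive param (F : Type) : Type :=
  | Type1 (c : F)
  | Type2 (c d : F)
  | Type3 (c d : F)
  | Type4 (c q : F).

Definition params (F : Type) (Q : set F) : set (param F) :=
  [set p | if p is Type4 _ q then Q q else True].

Definition rep (F : fieldType) (V : vectType F) (v : 2.-tuple V)
    (p : param F) : W2 V :=
  match p with
  | Type1 c => e8 v + e2 v - e1 v
               + c *: (3%:R *: e8 v + e5 v - 2%:R *: e1 v)
  | Type2 c d => - e1 v + c *: (e5 v - 2%:R *: e1 v) + d *: e8 v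
  | Type3 c d => - e1 v - 2%:R *: e8 v + 4%:R *: e3 v + e6 v + 3%:R *: e7 v
                 + c *: (3%:R *: e8 v - e5 v + 2%:R *: e1 v) + d *: e4 v
  | Type4 c q => - e1 v - 2%:R *: e8 v
                 + c *: (3%:R *: e8 v - e5 v + 2%:R *: e1 v) + q *: e4 v
  end.

(* Main.v *)
(* In coordinates, e.e = e is a system of eight quadratic equations. If the
   v_2-coefficient q of e(v_1,v_1) is nonzero, a unique S_b T_a brings
   e(v_1,v_1) to -v_1 + v_2, and the equations then leave one free coefficient
   (type 1).
   If q = 0, then e = 0 or e(v_1,v_1) = -v_1; let s be the v_2-coefficient of
   e(v_1,v_2). When s <> -1, some T_a kills the v_1-coefficient of e(v_1,v_2)
   and only type 2 remains. When s = -1, some T_a makes the v_1-coefficient t of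
   e(v_2,v_1) and the v_2-coefficient of e(v_2,v_2) opposite; on such forms the
   remaining freedom is t |-> b t, w |-> b^2 w, where w is the v_1-coefficient
   of e(v_2,v_2). The case t <> 0 gives type 3; if t = 0, then w <> 0 gives
   type 4, and w = 0 gives the members of type 2 with s = -1. *)
Require Import Defs.
From mathcomp Require Import all_boot all_order all_algebra.
From mathcomp Require Import boolp classical_sets.
From mathcomp Require Import ring.

Import GRing.Theory.
Local Open Scope ring_scope.
Local Open Scope classical_set_scope.

Section Coordinates.
Set Implicit Arguments.
Unset Strict Implicit.
Variables (F : fieldType) (V : vectType F) (v : 2.-tuple V).
Hypothesis hv : basis_of {:V} v.

(** * Coordinates of vectors and of bilinear maps *)

Definition vec (x y : F) : V := x *: v`_0 + y *: v`_1.

Lemma vecD x y x' y' : vec x y + vec x' y' = vec (x + x') (y + y').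
Proof. by rewrite /vec addrACA -!scalerDl. Qed.

Lemma vecZ k x y : k *: vec x y = vec (k * x) (k * y).
Proof. by rewrite /vec scalerDr !scalerA. Qed.

Lemma vecN x y : - vec x y = vec (- x) (- y).
Proof. by rewrite -scaleN1r vecZ !mulN1r. Qed.

Lemma vec10 : v`_0 = vec 1 0.
Proof. by rewrite /vec scale1r scale0r addr0. Qed.

Lemma coord_vec x y : (coord v 0 (vec x y) = x) * (coord v 1 (vec x y) = y).
Proof.
have fv := basis_free hv; have c i j := coord_free i (j : 'I_2) fv.
rewrite /vec !linearD !linearZ /= (c 0 0) (c 1 0) (c 0 1) (c 1 1) !eqxx /=.
by rewrite !mulr1 !mulr0 addr0 add0r.
Qed.

Lemma vec_coord x : x = vec (coord v 0 x) (coord v 1 x).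
Proof.
rewrite {1}(coord_basis hv (memvf x)) big_ord_recl big_ord1 /vec.
by congr (_ *: _ + coord v _ _ *: _); apply/val_inj.
Qed.

Lemma vec_inj x y x' y' : vec x y = vec x' y' -> x = x' /\ y = y'.
Proof.
move=> E; split.
  by have := congr1 (coord v 0) E; rewrite !coord_vec.
by have := congr1 (coord v 1) E; rewrite !coord_vec.
Qed.

(* (p, q), (r, s), (t, u), (w, z) are the coordinates of the values at
   (v_1,v_1), (v_1,v_2), (v_2,v_1), (v_2,v_2). *)
Definition bil (p q r s t u w z : F) : W2 V :=
  bilin (fun x y =>
    vec (coord v 0 x * coord v 0 y * p + coord v 0 x * coord v 1 y * r
         + coord v 1 x * coord v 0 y * t + coord v 1 x * coord v 1 y * w)
        (coord v 0 x * coord v 0 y * q + coord v 0 x * coord v 1 y * s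
         + coord v 1 x * coord v 0 y * u + coord v 1 x * coord v 1 y * z)).

Lemma bil_vec p q r s t u w z a b c d :
  bil p q r s t u w z (vec a b) (vec c d) =
  vec (a * c * p + a * d * r + b * c * t + b * d * w)
      (a * c * q + a * d * s + b * c * u + b * d * z).
Proof.
rewrite /bil bilinE ?coord_vec // => x k y y'.
- rewrite vecZ vecD !linearD !linearZ /=; congr vec; ring.
- rewrite vecZ vecD !linearD !linearZ /=; congr vec; ring.
Qed.

Lemma W2_ext (A B : W2 V) :
  (forall a b c d, A (vec a b) (vec c d) = B (vec a b) (vec c d)) -> A = B.
Proof.
move=> E; apply/lfunP=> x; apply/lfunP=> y.
by rewrite (vec_coord x) (vec_coord y) E.
Qed.

Lemma W2_vec (A : W2 V) a b c d :
  A (vec a b) (vec c d) = (a * c) *: A v`_0 v`_0 + (a * d) *: A v`_0 v`_1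
    + (b * c) *: A v`_1 v`_0 + (b * d) *: A v`_1 v`_1.
Proof.
rewrite /vec !linearD !linearZ /= !(add_lfunE, scale_lfunE) !scalerDr !scalerA.
by rewrite addrACA !addrA ![_ * c]mulrC ![_ * d]mulrC.
Qed.

Lemma W2_bil (A : W2 V) : exists p q r s t u w z, A = bil p q r s t u w z.
Proof.
pose m (i j : nat) k := coord v k (A v`_i v`_j).
exists (m 0%N 0%N 0), (m 0%N 0%N 1), (m 0%N 1%N 0), (m 0%N 1%N 1).
exists (m 1%N 0%N 0), (m 1%N 0%N 1), (m 1%N 1%N 0), (m 1%N 1%N 1).
have E i j : A v`_i v`_j = vec (m i j 0) (m i j 1) by exact: vec_coord.
by apply: W2_ext => a b c d; rewrite bil_vec W2_vec !E !vecZ !vecD.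
Qed.

Lemma bil_inj p q r s t u w z p' q' r' s' t' u' w' z' :
  bil p q r s t u w z = bil p' q' r' s' t' u' w' z' ->
  [/\ p = p' /\ q = q', r = r' /\ s = s', t = t' /\ u = u' & w = w' /\ z = z'].
Proof.
move=> E.
have ev a b c d := congr1 (fun A : W2 V => A (vec a b) (vec c d)) E.
have := ev 1 0 1 0; have := ev 1 0 0 1; have := ev 0 1 1 0; have := ev 0 1 0 1.
rewrite /= !bil_vec !(mulr1, mulr0, mul0r, mul1r, addr0, add0r).
by do 4!move=> /vec_inj ?.
Qed.

Lemma bilD p q r s t u w z p' q' r' s' t' u' w' z' :
  bil p q r s t u w z + bil p' q' r' s' t' u' w' z' =
  bil (p + p') (q + q') (r + r') (s + s') (t + t') (u + u') (w + w') (z + z').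
Proof.
apply: W2_ext => a b c d; rewrite !add_lfunE !bil_vec vecD; congr vec; ring.
Qed.

Lemma bilZ k p q r s t u w z :
  k *: bil p q r s t u w z =
  bil (k * p) (k * q) (k * r) (k * s) (k * t) (k * u) (k * w) (k * z).
Proof.
apply: W2_ext => a b c d; rewrite !scale_lfunE !bil_vec vecZ; congr vec; ring.
Qed.

Lemma bilN p q r s t u w z :
  - bil p q r s t u w z =
  bil (- p) (- q) (- r) (- s) (- t) (- u) (- w) (- z).
Proof. by rewrite -scaleN1r bilZ !mulN1r. Qed.

Lemma bil0 : 0 = bil 0 0 0 0 0 0 0 0.
Proof.
by have := bilZ 0 0 0 0 0 0 0 0 0; rewrite scale0r !mul0r.
Qed.

Lemma alpha_bil i j k :
  let m i' j' k' := ((i == i') && (j == j') && (k == k'))%:R in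
  alpha v i j k = bil (m 0 0 0) (m 0 0 1) (m 0 1 0) (m 0 1 1)
                      (m 1 0 0) (m 1 0 1) (m 1 1 0) (m 1 1 1).
Proof.
move=> m; apply: W2_ext => a b c d.
rewrite bil_vec W2_vec (alphaE hv i j k 0 0) (alphaE hv i j k 0 1).
rewrite (alphaE hv i j k 1 0) (alphaE hv i j k 1 1).
have -> : v`_k = vec (k == 0)%:R (k == 1)%:R.
  by case: k @m => [[|[|//]] ?] _;
    rewrite -!val_eqE /vec /= scale1r scale0r ?addr0 ?add0r.
by rewrite !vecZ !vecD /m -!mulnb !natrM.
Qed.

(** * Coordinates of the basis elements and of the representatives *)

Lemma e1_bil : e1 v = bil 1 0 0 (-1) 0 (-1) 0 0.
Proof. rewrite /e1 !alpha_bil /= !(bilN, bilZ, bilD); congr bil; ring. Qed.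
Lemma e2_bil : e2 v = bil 0 1 0 0 0 0 0 0.
Proof. by rewrite /e2 alpha_bil. Qed.
Lemma e3_bil : e3 v = bil 0 0 (-1) 0 (-1) 0 0 1.
Proof. rewrite /e3 !alpha_bil /= !(bilN, bilZ, bilD); congr bil; ring. Qed.
Lemma e4_bil : e4 v = bil 0 0 0 0 0 0 1 0.
Proof. by rewrite /e4 alpha_bil. Qed.
Lemma e5_bil : e5 v = bil 2%:R 0 0 1 0 1 0 0.
Proof. rewrite /e5 !alpha_bil /= !(bilN, bilZ, bilD); congr bil; ring. Qed.
Lemma e6_bil : e6 v = bil 0 0 1 0 1 0 0 2%:R.
Proof. rewrite /e6 !alpha_bil /= !(bilN, bilZ, bilD); congr bil; ring. Qed.
Lemma e7_bil : e7 v = bil 0 0 1 0 (-1) 0 0 0.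
Proof. rewrite /e7 !alpha_bil /= !(bilN, bilZ, bilD); congr bil; ring. Qed.
Lemma e8_bil : e8 v = bil 0 0 0 1 0 (-1) 0 0.
Proof. rewrite /e8 !alpha_bil /= !(bilN, bilZ, bilD); congr bil; ring. Qed.

Definition e_bil :=
  (e1_bil, e2_bil, e3_bil, e4_bil, e5_bil, e6_bil, e7_bil, e8_bil).

Lemma rep1_bil c : rep v (Type1 c) = bil (-1) 1 0 (2%:R + 6%:R * c) 0 0 0 0.
Proof. rewrite /rep !e_bil !(bilN, bilZ, bilD); congr bil; ring. Qed.

(* Common shape of the representatives of types 2, 3 and 4. *)
Definition nf s t u w : W2 V := bil (-1) 0 0 s t u w (- t).

Lemma rep2_nf c d :
  rep v (Type2 c d) = nf (1 + 3%:R * c + d) 0 (1 + 3%:R * c - d) 0.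
Proof. rewrite /rep /nf !e_bil !(bilN, bilZ, bilD); congr bil; ring. Qed.

Lemma rep3_nf c d :
  rep v (Type3 c d) = nf (-1) (- 6%:R) (3%:R - 6%:R * c) d.
Proof. rewrite /rep /nf !e_bil !(bilN, bilZ, bilD); congr bil; ring. Qed.

Lemma rep4_nf c q : rep v (Type4 c q) = nf (-1) 0 (3%:R - 6%:R * c) q.
Proof. rewrite /rep /nf !e_bil !(bilN, bilZ, bilD); congr bil; ring. Qed.

(** * The automorphisms and the product in coordinates *)

Lemma endo_vec x1 y1 x2 y2 a b :
  endo v (vec x1 y1) (vec x2 y2) (vec a b) =
  vec (a * x1 + b * x2) (a * y1 + b * y2).
Proof.
have [E0 E1] := endoE (vec x1 y1) (vec x2 y2) hv.
by rewrite {3}/vec linearD !linearZ /= E0 E1 !vecZ vecD.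
Qed.

(** In general [f^-1] is only a pseudo-inverse. A right inverse [g] makes [f] surjective, hence
    injective by rank-nullity, and then [f^-1] must be [g]. *)
Lemma inv_lfun_vec (f g : 'End(V)) :
  (forall a b, f (g (vec a b)) = vec a b) -> forall x, (f^-1)%VF x = g x.
Proof.
move=> fg x.
have fgK y : f (g y) = y by rewrite (vec_coord y) fg.
have kf : lker f == 0%VS.
  have lf : limg f = fullv.
    apply/eqP; rewrite eqEsubv subvf /=; apply/subvP=> y _.
    by rewrite -(fgK y) memv_img ?memvf.
  have := limg_ker_dim f fullv; rewrite lf capfv => /eqP.
  by rewrite -{2}[\dim fullv]add0n eqn_add2r dimv_eq0.
by rewrite -{1}(fgK x) lker0_lfunK.
Qed.

Lemma Ta_bil a p q r s t u w z :
  Ta v a (bil p q r s t u w z) =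
  bil (p + a * q) q
      (r - a * p + a * (s - a * q)) (s - a * q)
      (t - a * p + a * (u - a * q)) (u - a * q)
      (w - a * (r + t) + a ^+ 2 * p + a * (z - a * (s + u) + a ^+ 2 * q))
      (z - a * (s + u) + a ^+ 2 * q).
Proof.
have E x y : Ta v a (bil p q r s t u w z) x y =
    endo v (vec 1 0) (vec a 1) (bil p q r s t u w z
      (endo v (vec 1 0) (vec (- a) 1) x) (endo v (vec 1 0) (vec (- a) 1) y)).
  have Ea : v`_1 + a *: v`_0 = vec a 1 by rewrite /vec scale1r addrC.
  rewrite /Ta PhiE Ea vec10.
  rewrite !(@inv_lfun_vec _ (endo v (vec 1 0) (vec (- a) 1))) //;
    by move=> x' y'; rewrite !endo_vec; congr vec; ring.
by apply: W2_ext => x y x' y'; rewrite E !(endo_vec, bil_vec); congr vec; ring.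
Qed.

(** Each argument v_2 contributes a factor [b], and an output along v_2 contributes [b^-1]. *)
Lemma Sb_bil b p q r s t u w z : b != 0 ->
  Sb v b (bil p q r s t u w z) =
  bil p (b^-1 * q) (b * r) s (b * t) u (b ^+ 2 * w) (b * z).
Proof.
move=> b0.
have E x y : Sb v b (bil p q r s t u w z) x y =
    endo v (vec 1 0) (vec 0 b^-1) (bil p q r s t u w z
      (endo v (vec 1 0) (vec 0 b) x) (endo v (vec 1 0) (vec 0 b) y)).
  have Eb : b^-1 *: v`_1 = vec 0 b^-1 by rewrite /vec scale0r add0r.
  rewrite /Sb PhiE Eb vec10 !(@inv_lfun_vec _ (endo v (vec 1 0) (vec 0 b))) //;
    by move=> x' y'; rewrite !endo_vec; congr vec; field.
by apply: W2_ext => x y x' y'; rewrite E !(endo_vec, bil_vec); congr vec; field.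
Qed.

(** Equating these entries with those of [A] gives the eight quadratic equations. *)
Lemma mulW_bil p q r s t u w z :
  let A := bil p q r s t u w z in
  mulW v A A =
  bil (- p ^+ 2 - q * t) (- q * (p + u)) (- p * r - q * w) (- p * s - q * z)
      (u * r - r * p - s * t - q * w) (t * q - r * q - p * u - q * z)
      (w * p + z * r - r ^+ 2 - 2%:R * s * w - r * t)
      (w * q - z * s - r * s - r * u).
Proof.
apply: W2_ext => a b c d; rewrite mulWE vec10 !bil_vec !(vecN, vecD).
congr vec; ring.
Qed.

(** * Orbits of the representatives *)

Lemma act_rep1 a b c : b != 0 ->
  Sb v b (Ta v a (rep v (Type1 c))) =
  bil (a - 1) b^-1
      (b * (a + a * (2%:R + 6%:R * c - a))) (2%:R + 6%:R * c - a)
      (b * (a - a ^+ 2)) (- a)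
      (- b ^+ 2 * a ^+ 2 * (3%:R + 6%:R * c - a))
      (- b * a * (2%:R + 6%:R * c - a)).
Proof.
by move=> b0; rewrite rep1_bil Ta_bil Sb_bil //; congr bil; ring.
Qed.

(** The entries [s] and [u] come out unchanged, so they are orbit invariants. *)
Lemma act_nf a b s t u w : b != 0 ->
  Sb v b (Ta v a (nf s t u w)) =
  bil (-1) 0 (b * a * (1 + s)) s (b * (t + a * (1 + u))) u
      (b ^+ 2 * (w - 2%:R * a * t - a ^+ 2 * (1 + s + u)))
      (- b * (t + a * (s + u))).
Proof.
by move=> b0; rewrite /nf Ta_bil Sb_bil //; congr bil; ring.
Qed.

(** Nonvanishing is read off the value at (v_1,v_1): its v_2-coefficient is [b^-1] for type 1, and
    its v_1-coefficient is -1 for the other types. *)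
Lemma orbit_rep_idempotent p A :
  orbitW v (rep v p) A -> A != 0 /\ mulW v A A = A.
Proof.
move=> [a [b [b0 ->{A}]]]; split; last first.
  by case: p => [c|c d|c d|c q];
    rewrite ?rep2_nf ?rep3_nf ?rep4_nf ?act_rep1 ?act_nf // mulW_bil;
    congr bil; field.
apply/eqP; rewrite bil0; case: p => [c|c d|c d|c q];
  rewrite ?rep2_nf ?rep3_nf ?rep4_nf ?act_rep1 ?act_nf //;
  move=> /bil_inj [[p0 q0] _ _ _].
- by move: b0; rewrite -invr_eq0 q0 eqxx.
all: by move/eqP: p0; rewrite oppr_eq0 oner_eq0.
Qed.

(** * Disjointness of the orbits *)

Hypothesis two0 : 2%:R != 0 :> F.

(** If [s = -1], the v_1-coefficient at (v_2,v_1) and the v_2-coefficient at (v_2,v_2) of the image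
    add up to [2 * (b * a)]. This fixes [b * a]; removing its contributions recovers [b * t] and
    then [b ^+ 2 * w]. *)
Lemma act_nf_inj a b s t u w a' b' s' t' u' w' : b != 0 -> b' != 0 ->
  Sb v b (Ta v a (nf s t u w)) = Sb v b' (Ta v a' (nf s' t' u' w')) ->
  [/\ s = s', u = u' &
      s = -1 -> b * t = b' * t' /\ b ^+ 2 * w = b' ^+ 2 * w'].
Proof.
move=> b0 b0'; rewrite !act_nf // => /bil_inj [_ [_ es] [Et eu] [Ew Ez]].
subst s' u'; split=> // s1; rewrite {}s1 in Ew Ez.
have Ea : b * a = b' * a'.
  apply: (mulfI two0).
  transitivity (b * (t + a * (1 + u)) + - b * (t + a * (-1 + u))).
    by ring.
  by rewrite Et Ez; ring.
have Et' : b * t = b' * t'.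
  transitivity (b * (t + a * (1 + u)) - b * a * (1 + u)); first by ring.
  by rewrite Et Ea; ring.
split=> //.
transitivity (b ^+ 2 * (w - 2%:R * a * t - a ^+ 2 * (1 + -1 + u))
  + 2%:R * (b * a) * (b * t) + (b * a) ^+ 2 * u); first by ring.
by rewrite Ew Et' Ea; ring.
Qed.

Hypothesis three0 : 3%:R != 0 :> F.

Let six0 : 6%:R != 0 :> F.
Proof. by rewrite (natrM F 2 3) mulf_neq0. Qed.

Variable Q : set F.
Hypothesis hQ : square_class_reps Q.

Lemma orbit_rep_inj p p' A : params Q p -> params Q p' ->
  orbitW v (rep v p) A -> orbitW v (rep v p') A -> p = p'.
Proof.
move=> Qp Qp' [a [b [b0 ->{A}]]] [a' [b' [b0' E]]].
have [Q0 _] := hQ.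
(* The v_2-coefficient at (v_1,v_1) is nonzero for type 1 and zero for the other types. *)
have neq x y c1 s t u w : x != 0 -> y != 0 ->
    Sb v x (Ta v a (rep v (Type1 c1))) <> Sb v y (Ta v a' (nf s t u w)) /\
    Sb v y (Ta v a (nf s t u w)) <> Sb v x (Ta v a' (rep v (Type1 c1))).
  move=> x0 y0; rewrite !act_rep1 // !act_nf //.
  by split=> /bil_inj [[_ /eqP]]; rewrite ?(eq_sym 0) invr_eq0 (negPf x0).
have C34 (c c' : F) : 3%:R - 6%:R * c = 3%:R - 6%:R * c' -> c = c'.
  by move=> /addrI/oppr_inj/(mulfI six0).
case: p p' Qp Qp' E => [c|c d|c d|c q] [c'|c' d'|c' d'|c' q'] Qp Qp';
  rewrite ?rep2_nf ?rep3_nf ?rep4_nf => E.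
- move: E; rewrite !act_rep1 // => /bil_inj [[/addIr <- _] [_ /addIr Ec] _ _].
  by move: Ec => /addrI/(mulfI six0) ->.
- by case: (neq _ _ c (1 + 3%:R * c' + d') 0 (1 + 3%:R * c' - d') 0 b0 b0').
- by case: (neq _ _ c (-1) (- 6%:R) (3%:R - 6%:R * c') d' b0 b0').
- by case: (neq _ _ c (-1) 0 (3%:R - 6%:R * c') q' b0 b0').
- by case: (neq _ _ c' (1 + 3%:R * c + d) 0 (1 + 3%:R * c - d) 0 b0' b0).
(* In type 2, [s + u = 2 + 6c] determines [c], and then [s] determines [d]. *)
- have [Es Eu _] := act_nf_inj b0 b0' E.
  have Ec : c = c'.
    apply: (mulfI six0).
    transitivity ((1 + 3%:R * c + d) + (1 + 3%:R * c - d) - 2%:R).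
      by ring.
    by rewrite Es Eu; ring.
  by rewrite -Ec in Es *; move/addrI: Es => ->.
(* Type 2 has [t = w = 0], against [t = -6] in type 3 and [w = q'] nonzero in type 4. *)
- have [Es _ /(_ Es) []] := act_nf_inj b0 b0' E.
  move=> /eqP; rewrite mulr0 eq_sym mulrN oppr_eq0 mulf_eq0 (negPf six0).
  by rewrite (negPf b0').
- have [Es _ /(_ Es) [_ /eqP]] := act_nf_inj b0 b0' E.
  by rewrite mulr0 eq_sym mulf_eq0 expf_eq0 (negPf b0') (negPf (Q0 _ Qp')).
- by case: (neq _ _ c' (-1) (- 6%:R) (3%:R - 6%:R * c) d b0' b0).
- have [_ _ /(_ erefl) []] := act_nf_inj b0 b0' E.
  by move=> /eqP; rewrite mulr0 mulrN oppr_eq0 mulf_eq0 (negPf six0) (negPf b0).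
(* The common value [t = -6] forces [b = b'], hence equal [d]. *)
- have [_ /C34 -> /(_ erefl) []] := act_nf_inj b0 b0' E.
  rewrite !mulrN => /oppr_inj/(mulIf six0) <-.
  by move=> /(mulfI (expf_neq0 2 b0)) ->.
- have [_ _ /(_ erefl) []] := act_nf_inj b0 b0' E.
  by move=> /eqP; rewrite mulr0 mulrN oppr_eq0 mulf_eq0 (negPf six0) (negPf b0).
- by case: (neq _ _ c' (-1) 0 (3%:R - 6%:R * c) q b0' b0).
- have [_ _ /(_ erefl) [_ /eqP]] := act_nf_inj b0 b0' E.
  by rewrite mulr0 mulf_eq0 expf_eq0 (negPf b0) (negPf (Q0 _ Qp)).
- have [_ _ /(_ erefl) []] := act_nf_inj b0 b0' E.
  move=> /eqP; rewrite mulr0 eq_sym mulrN oppr_eq0 mulf_eq0 (negPf six0).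
  by rewrite (negPf b0').
(* Since [b ^+ 2 * q = b' ^+ 2 * q'], both parameters represent the same square class, so they
   coincide in [Q]. *)
- have [_ /C34 -> /(_ erefl) [_ Eq]] := act_nf_inj b0 b0' E.
  have x0 : b ^+ 2 * q != 0 by exact: mulf_neq0 (expf_neq0 2 b0) (Q0 q Qp).
  have [q1 [_ uq]] := hQ.2 _ x0; congr Type4.
  transitivity q1.
    by rewrite -(uq q) //; split=> //; exists b; rewrite // mulrC.
  by apply: uq; split=> //; exists b'; rewrite // Eq mulrC.
Qed.

(** * Every nonzero idempotent lies in one of the orbits *)

Lemma idempotent_in_orbit A : A != 0 -> mulW v A A = A ->
  exists2 p, params Q p & orbitW v (rep v p) A.
Proof.
have [p [q [r [s [t [u [w [z ->{A}]]]]]]]] := W2_bil A => A0.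
rewrite mulW_bil => /bil_inj [[Ep Eq] [Er Es] [Et Eu] [Ew Ez]].
have [q0|q0] := eqVneq q 0; last first.
  (* For [q] nonzero, five equations express [u], [t], [z], [w], [r] through [p], [q], [s]. *)
  have u1 : u = -1 - p.
    apply: (mulfI (_ : - q != 0)); first by rewrite oppr_eq0.
    transitivity (- q * (p + u) + q * p); first by ring.
    by rewrite Eq; ring.
  have t1 : t = - (p + p ^+ 2) / q.
    apply: (mulfI q0).
    transitivity (- (- p ^+ 2 - q * t) - p ^+ 2); first by ring.
    by rewrite Ep; field.
  have z1 : z = - s * (1 + p) / q.
    apply: (mulfI q0).
    transitivity (- (- p * s - q * z) - p * s); first by ring.
    by rewrite Es; field.
  have w1 : w = - r * (1 + p) / q.
    apply: (mulfI q0).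
    transitivity (- (- p * r - q * w) - p * r); first by ring.
    by rewrite Er; field.
  have r1 : r = (1 + p) * (1 + s) / q.
    apply: (mulfI q0).
    transitivity (- (t * q - r * q - p * u - q * z) + t * q - p * u - q * z).
      by ring.
    by rewrite Eu u1 t1 z1; field.
  (* Solves [a - 1 = p], [b^-1 = q] and [2 + 6c - a = s] from [act_rep1]. *)
  exists (Type1 ((s + p - 1) / 6%:R)) => //; exists (p + 1), q^-1.
  split; first by rewrite invr_eq0.
  rewrite act_rep1 ?invr_eq0 //; rewrite w1 z1 t1 u1 r1.
  by congr bil; field; rewrite ?q0 ?six0 ?oner_neq0.
rewrite {q}q0 in Ep Eq Er Es Et Eu Ew Ez A0 *.
have p1 : p = -1.
  have /eqP : p * (p + 1) = 0.
    by transitivity (p - (- p ^+ 2 - 0 * t)); [ring | rewrite Ep subrr].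
  rewrite mulf_eq0 addr_eq0 => /orP[/eqP p0|/eqP //].
  case/eqP: A0; rewrite bil0; rewrite {p}p0 in Ep Eq Er Es Et Eu Ew Ez *.
  have r0 : r = 0 by rewrite -Er; ring.
  have s0 : s = 0 by rewrite -Es; ring.
  have u0 : u = 0 by rewrite -Eu r0; ring.
  have t0 : t = 0 by rewrite -Et r0 s0; ring.
  have z0 : z = 0 by rewrite -Ez r0 s0; ring.
  by rewrite -Ew z0 r0 s0 t0 u0; congr bil; ring.
clear Ep Eq Er Es Eu A0; rewrite {}p1 in Et Ew Ez *.
(* The three remaining equations give [t], [z] and [w] successively, each with [1 + s] in its
   leading coefficient. *)
have Et' : t * (1 + s) = r * (1 + u).
  by apply: subr0_eq; transitivity (t - (u * r - r * -1 - s * t - 0 * w));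
    [ring | rewrite Et subrr].
have Ez' : z * (1 + s) = - r * (s + u).
  by apply: subr0_eq; transitivity (z - (w * 0 - z * s - r * s - r * u));
    [ring | rewrite Ez subrr].
have Ew' : 2%:R * w * (1 + s) = r * (z - r - t).
  apply: subr0_eq.
  by transitivity (w - (w * -1 + z * r - r ^+ 2 - 2%:R * s * w - r * t));
    [ring | rewrite Ew subrr].
have [s1|s1] := eqVneq s (-1); last first.
  have s1' : 1 + s != 0 by rewrite addrC addr_eq0.
  have t1 : t = r * (1 + u) / (1 + s) by rewrite -Et' mulfK.
  have z1 : z = - r * (s + u) / (1 + s) by rewrite -Ez' mulfK.
  have w1 : w = r * (z - r - t) / (2%:R * (1 + s)).
    by rewrite -Ew'; field; rewrite two0 s1'.
  (* Solves [1 + 3c + d = s] and [1 + 3c - d = u]; the shift comes from [a * (1 + s) = r] with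
     [b = 1]. *)
  exists (Type2 ((s + u - 2%:R) / 6%:R) ((s - u) / 2%:R)) => //.
  exists (r / (1 + s)), 1; split; first exact: oner_neq0.
  rewrite rep2_nf act_nf ?oner_neq0 // w1 z1 t1.
  by congr bil; field; rewrite ?two0 ?six0 ?s1'.
clear Et Ew Ez; rewrite {}s1 in Et' Ez' Ew' *.
have r0 : r = 0.
  apply: (mulfI two0).
  transitivity (r * (1 + u) + - r * (-1 + u)); first by ring.
  by rewrite -Et' -Ez'; ring.
clear Et' Ez' Ew'; rewrite {}r0.
(* By [act_nf] at [s = -1], [t + z] is twice the product of shift and scale; [a] denotes that
   product, whence the shifts [a / b] and [a / y] below. Undoing the shift leaves [-6 * b] in place
   of [t], which is the type 3 entry scaled by [b], and [w0] in place of [w]. *)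
have [a zE] : exists a, z = 2%:R * a - t by exists ((t + z) / 2%:R); field.
have [b tE] : exists b, t = - (6%:R * b) + a * (1 + u).
  by exists (- ((t - a * (1 + u)) / 6%:R)); field.
have [w0 wE] : exists w0, w = w0 + 12%:R * a * b - a ^+ 2 * u.
  by exists (w - 12%:R * a * b + a ^+ 2 * u); ring.
have uE : u = 3%:R - 6%:R * ((3%:R - u) / 6%:R) by field.
rewrite zE wE tE; have [b0|b0] := eqVneq b 0; last first.
  exists (Type3 ((3%:R - u) / 6%:R) (w0 / b ^+ 2)) => //.
  exists (a / b), b; split=> //; rewrite rep3_nf -uE act_nf //.
  by congr bil; field.
rewrite {}b0; have [w00|w00] := eqVneq w0 0.
  exists (Type2 ((u - 3%:R) / 6%:R) (- (1 + u) / 2%:R)) => //; exists a, 1.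
  split; first exact: oner_neq0.
  rewrite rep2_nf act_nf ?oner_neq0 // w00.
  by congr bil; field; rewrite ?two0 ?six0.
(* The scale [y] with [w0 = q * y ^+ 2] carries the entry [q] of type 4 to [w0]. *)
have [q [[Qq [y y0 wq]] _]] := hQ.2 _ w00.
exists (Type4 ((3%:R - u) / 6%:R) q) => //; exists (a / y), y.
split=> //; rewrite rep4_nf -uE act_nf // wq.
by congr bil; field.
Qed.

End Coordinates.

Theorem theorem13 (F : fieldType) (hF : [pchar F] =i pred0)
    (V : vectType F) (v : 2.-tuple V) (hv : basis_of {:V} v)
    (Q : set F) (hQ : square_class_reps Q) :
  [set e : W2 V | e != 0 /\ mulW v e e = e] =
    \bigcup_(p in params Q) orbitW v (rep v p)
  /\ trivIset (params Q) (fun p => orbitW v (rep v p)).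
Proof.
(* Characteristic zero supplies the invertibility of 2 and 3. *)
have natr0 n : n.+1%:R != 0 :> F by rewrite (pcharf0P F).1.
split.
  apply/seteqP; split=> [A [A0 AA]|A [p _ /(orbit_rep_idempotent hv)]] //.
  have [p Qp pA] := idempotent_in_orbit hv (natr0 1%N) (natr0 2%N) hQ A0 AA.
  by exists p.
move=> p p' Qp Qp' [A [pA pA']].
by have := orbit_rep_inj hv (natr0 1%N) (natr0 2%N) hQ Qp Qp' pA pA'.
Qed.
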